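(* In $\mathcal{E}$-Wythoff, a position $(a,b)$ with $a \leq b$ has Sprague-Grundy value $1$ if and only if $(a,b) = (\lfloor \phi n \rfloor - 1, \lfloor \phi n \rfloor +n-1)$ for some integer $n \geq 1$, where $\phi=(1+\sqrt5)/2$.
   Context: A position is an unordered pair $(a,b)$ of nonnegative integers (pile sizes). $\mathcal{E}$-Wythoff: a move either removes a positive number of tokens from one pile, or removes the same positive number of tokens from both piles, or removes $k$ tokens from the smaller pile (or from either pile if the piles are equal) and $l$ tokens from the other pile, for integers $k \geq 1$, $l\ge 0$ with $l < k$. The Sprague-Grundy function is $\mathcal{G}(p)=\mathrm{mex}\{\mathcal{G}(q): q \text{ reachable from } p \text{ in one move}\}$, where $\mathrm{mex}(S)$ is the least nonnegative integer not in $S$ and $\mathrm{mex}\{\}=0$. *)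

(* Defs.v *)
From mathcomp Require Import all_boot all_order all_algebra.
From mathcomp Require Import reals.

Set Implicit Arguments.
Unset Strict Implicit.
Unset Printing Implicit Defensive.

Import Order.TTheory GRing.Theory Num.Theory.

Lemma mex_subproof (s : seq nat) : exists n, n \notin s.
Proof.
exists (\max_(i <- s) i).+1; apply/negP => sP.
by have := @leq_bigmax_seq nat s predT id _ sP isT; rewrite ltnn.
Qed.

Definition mex (s : seq nat) : nat := ex_minn (mex_subproof s).

Lemma mexP (s : seq nat) (m : nat) :
  reflect (m \notin s /\ forall k, k < m -> k \in s) (mex s == m).
Proof.
apply: (iffP eqP) => [<-|[mNs ltms]]; rewrite /mex; case: ex_minnP => n nNs nmin.
  split=> // k ltkn; apply/negPn/negP => /nmin.
  by rewrite leqNgt ltkn.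
apply/eqP; rewrite eqn_leq nmin //= leqNgt; apply/negP => /ltms.
by rewrite (negPf nNs).
Qed.

(* A position is stored as an ordered pair of pile sizes. The rules below do
   not depend on the order of the piles, see [ew_grundyC]. *)
Definition position : Type := (nat * nat)%type.

(* [ew_legal p x y]: one may remove x tokens from the pile p.1 and, in the same
   move, y tokens from the pile p.2. The last two disjuncts remove k from a
   smallest pile and l < k from the other one. *)
Definition ew_legal (p : position) (x y : nat) : bool :=
  [&& x <= p.1, y <= p.2 &
      [|| (0 < x) && (y == 0),
          (x == 0) && (0 < y),
          (0 < x) && (x == y),
          [&& p.1 <= p.2, 0 < x & y < x] |
          [&& p.2 <= p.1, 0 < y & x < y]]].

Definition ew_options (p : position) : seq position :=
  [seq (p.1 - xy.1, p.2 - xy.2) |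
     xy <- [seq (x, y) | x <- iota 0 p.1.+1, y <- iota 0 p.2.+1]
     & ew_legal p xy.1 xy.2].

(* The fuel is an upper bound on the length of the play; [ew_grundyE] is the
   recursive equation without fuel. *)
Fixpoint ew_grundy_rec (fuel : nat) (p : position) : nat :=
  if fuel is fuel'.+1
  then mex [seq ew_grundy_rec fuel' q | q <- ew_options p] else 0.

Definition ew_grundy (p : position) : nat := ew_grundy_rec (p.1 + p.2).+1 p.

Lemma ew_optionsP (p q : position) :
  reflect (exists x y, ew_legal p x y /\ q = (p.1 - x, p.2 - y))
          (q \in ew_options p).
Proof.
apply: (iffP mapP) => [[[x y]]|[x [y [xyP ->]]]].
  by rewrite mem_filter => /andP[xyP _] ->; exists x, y.
exists (x, y) => //; rewrite mem_filter xyP andTb.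
case/and3P: xyP => xa yb _.
apply/allpairsP; exists (x, y).
by rewrite !mem_iota !add0n !ltnS xa yb.
Qed.

Lemma ew_options_lt (p q : position) :
  q \in ew_options p -> q.1 + q.2 < p.1 + p.2.
Proof.
case/ew_optionsP=> x [y [/and3P[xa yb H] ->]] /=.
have xy : 0 < x + y.
  rewrite addn_gt0.
  by case/or4P: H => [/andP[]|/andP[]|/andP[]|/orP[]/and3P[]];
     do ?[move=> -> | move=> _ | by rewrite ?orbT].
rewrite -(subnK xa) -{2}(subnK yb) addnACA ?addnK -[X in X < _]addn0.
by rewrite ltn_add2l.
Qed.

Lemma ew_grundy_rec_fuel (m n : nat) (p : position) :
  p.1 + p.2 < m -> p.1 + p.2 < n -> ew_grundy_rec m p = ew_grundy_rec n p.
Proof.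
elim: m n p => [|m IHm] [|n] p //= ltpm ltpn; congr mex.
apply/eq_in_map => q /ew_options_lt ltqp.
by apply: IHm; [apply: leq_trans ltqp ltpm | apply: leq_trans ltqp ltpn].
Qed.

Lemma ew_grundyE (p : position) :
  ew_grundy p = mex [seq ew_grundy q | q <- ew_options p].
Proof.
rewrite {1}/ew_grundy /=; congr mex; apply/eq_in_map => q /ew_options_lt ltqp.
exact: ew_grundy_rec_fuel.
Qed.

Lemma eq_mem_mex (s t : seq nat) : s =i t -> mex s = mex t.
Proof.
move=> st; apply/eqP/mexP; have /mexP[mNt ltmt] := eqxx (mex t).
by split=> [|k /ltmt]; rewrite st.
Qed.

Lemma ew_optionsC (a b : nat) (q : position) :
  q \in ew_options (a, b) -> (q.2, q.1) \in ew_options (b, a).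
Proof.
case/ew_optionsP=> x [y [xyP ->]] /=; apply/ew_optionsP; exists y, x.
split=> //; move: xyP; rewrite /ew_legal /= => /and3P[-> ->] /=.
case/or4P=> [/andP[-> ->]|/andP[-> ->]|/andP[x0 /eqP <-]|/orP[]/and3P[-> -> ->]];
  by rewrite ?x0 ?eqxx ?orbT.
Qed.

Lemma ew_grundyC (a b : nat) : ew_grundy (a, b) = ew_grundy (b, a).
Proof.
have [n] := ubnP (a + b); elim: n a b => // n IHn a b ltabn.
rewrite !ew_grundyE; apply: eq_mem_mex => m.
apply/mapP/mapP => -[[c d] cdP ->]; exists (d, c); rewrite ?(ew_optionsC cdP) //.
  by apply: IHn; apply: leq_trans (ew_options_lt cdP) _.
by apply: IHn; apply: leq_trans (ew_options_lt cdP) _; rewrite addnC.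
Qed.

Definition phi {R : realType} : R := ((1 + Num.sqrt 5) / 2)%R.

(* Main.v *)
(* Let A n = floor (phi n).  By Beatty's theorem for phi and phi ^ 2 = phi + 1,
   every positive integer is exactly one of the numbers A n, A n + n with n > 0.
   The positions of value 0 are the Wythoff pairs (A n, A n + n): the moves that
   take k from the smaller pile and l < k from the other one shrink the smaller
   pile and enlarge the difference, so they never join two Wythoff pairs.  The
   positions of value 1 are the positive Wythoff pairs translated by (-1, -1).
   Translating back, moves between them are moves between Wythoff pairs, and the
   usual strategy reaches them from every other position (a, b) with a <> b; the
   additional moves are needed only to go from (a, a) to (0, 1). *)
Require Import Defs.
From mathcomp Require Import all_boot all_order all_algebra.
From mathcomp Require Import reals.
From mathcomp Require Import boolp zify ring lra.

Import Order.TTheory GRing.Theory Num.Theory.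

(** Infinite descent: a ratio [a / n] would be a root of [x ^ 2 = x + 1]; parity forces [a] and [n]
    to be even, and halving both preserves the equation. *)
Lemma golden_irrational (a n : nat) : a * a = a * n + n * n -> n = 0.
Proof.
have [k] := ubnP n; elim: k a n => // k IHk a n ltnk E.
have oE : odd (a * a) = odd (a * n + n * n) by rewrite E.
rewrite oddD !oddM in oE.
have [oa on] : odd a = false /\ odd n = false.
  by move: oE; case: (odd a); case: (odd n).
have a2 := odd_double_half a; have n2 := odd_double_half n.
rewrite oa add0n -muln2 in a2; rewrite on add0n -muln2 in n2.
have [-> //|n_gt0] := posnP n.
suff : n./2 = 0 by lia.
by apply: (IHk a./2); [lia | nia].
Qed.

(** * Beatty's theorem for phi and phi ^ 2 *)

Section Beatty.
Set Implicit Arguments.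
Unset Strict Implicit.
Local Open Scope ring_scope.
Variable R : realType.
Local Notation f := (phi : R).

Lemma phi_mul : f * f = f + 1.
Proof.
have s5 : Num.sqrt 5 ^+ 2 = 5 :> R by rewrite sqr_sqrtr.
by rewrite /phi; field: s5.
Qed.

Lemma phi_gt1 : 1 < f.
Proof.
have : 1 < Num.sqrt 5 :> R by rewrite -{1}[1]sqrtr1 ltr_sqrt; lra.
by rewrite /phi; lra.
Qed.

Lemma phi_lt2 : f < 2.
Proof. by have := phi_mul; have := phi_gt1; nra. Qed.

Lemma phi_mulK x : f * (f * x) = f * x + x.
Proof. by rewrite mulrA phi_mul mulrDl mul1r. Qed.

Lemma ltr_phi x y : (f * x < f * y) = (x < y).
Proof. by rewrite ltr_pM2l //; have := phi_gt1; lra. Qed.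

(** The inverse of phi is phi - 1, so this is division by phi. *)
Lemma phi_divK x : f * (x * (f - 1)) = x.
Proof. by ring: phi_mul. Qed.

Definition lower_wythoff (n : nat) : nat := Num.truncn (f * n%:R).
Local Notation A := lower_wythoff.

Lemma floor_phi n : Num.floor (f * n%:R) = (A n)%:Z.
Proof.
have := phi_gt1 => f1; rewrite /A truncn_floor ifT ?gez0_abs //.
  by rewrite floor_ge0 mulr_ge0 //; lra.
by rewrite mulr_ge0 //; lra.
Qed.

Lemma lower_wythoff_itv n : (A n)%:R <= f * n%:R < (A n)%:R + 1.
Proof.
rewrite natr1; apply: truncn_itv; rewrite mulr_ge0 //.
by have := phi_gt1; lra.
Qed.

Lemma lower_wythoff_eq (n a : nat) : a%:R <= f * n%:R < a%:R + 1 -> A n = a.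
Proof. by rewrite natr1; apply: truncn_def. Qed.

Lemma phi_irrational (a n : nat) : (0 < n)%N -> a%:R != f * n%:R.
Proof.
move=> n0; apply/eqP => E; suff : n = 0%N by lia.
apply: (@golden_irrational a); apply/eqP.
rewrite -(eqr_nat R) natrD !natrM E; apply/eqP.
by ring: phi_mul.
Qed.

Lemma lower_wythoff_lt n : (0 < n)%N -> (A n)%:R < f * n%:R.
Proof.
move=> n0; rewrite lt_neqAle phi_irrational //.
by case/andP: (lower_wythoff_itv n).
Qed.

Lemma lower_wythoff0 : A 0 = 0%N.
Proof. by apply: lower_wythoff_eq; rewrite mulr0 lexx add0r ltr01. Qed.

Lemma lower_wythoff_ltn m n : (m < n)%N -> (A m < A n)%N.
Proof.
move=> mn; rewrite -ltnS -(ltr_nat R) -!natr1.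
have [/andP[m1 m2] /andP[n1 n2]] := (lower_wythoff_itv m, lower_wythoff_itv n).
have : m%:R + 1 <= n%:R :> R by rewrite natr1 ler_nat.
by have := phi_gt1; nra.
Qed.

(* Dividing A m = A n + n by phi and by phi ^ 2 bounds m and n; as
   1 / phi + 1 / phi ^ 2 = 1, the sum m + n would lie strictly between two
   consecutive integers. *)
Lemma lower_upper_wythoff m n : A m = (A n + n)%N -> m = 0%N /\ n = 0%N.
Proof.
move=> E; have [n0|n0] := posnP n.
  split=> //; case: (posnP m) => // /lower_wythoff_ltn.
  by rewrite E n0 lower_wythoff0.
have m0 : (0 < m)%N by case: (posnP m) E => // ->; rewrite lower_wythoff0; lia.
have [/andP[_ m2] /andP[_ n2]] := (lower_wythoff_itv m, lower_wythoff_itv n).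
have [m1 n1] := (lower_wythoff_lt m0, lower_wythoff_lt n0).
have ER : (A m)%:R = (A n)%:R + n%:R :> R by rewrite E natrD.
set a : R := (A m)%:R in m1 m2 ER *.
have aE : a * (f - 1) * (f - 1) + a * (f - 1) = a by ring: phi_mul.
have a1E : (a + 1) * (f - 1) * (f - 1) + (a + 1) * (f - 1) = a + 1.
  by ring: phi_mul.
have m_gt : a * (f - 1) < m%:R by rewrite -ltr_phi phi_divK.
have m_lt : m%:R < (a + 1) * (f - 1) by rewrite -ltr_phi phi_divK.
have n_gt : a * (f - 1) * (f - 1) < n%:R.
  by rewrite -ltr_phi phi_divK -ltr_phi phi_divK phi_mulK; lra.
have n_lt : n%:R < (a + 1) * (f - 1) * (f - 1).
  by rewrite -ltr_phi phi_divK -ltr_phi phi_divK phi_mulK; lra.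
have lo : (A m)%:R < (m + n)%:R :> R by rewrite natrD; lra.
have hi : (m + n)%:R < (A m).+1%:R :> R by rewrite natrD -natr1; lra.
by rewrite !ltr_nat in lo hi; lia.
Qed.

(* Whether k is a lower or an upper Wythoff number is decided by the gap
   A (k + 1) - A k, which is 2 or 1. *)
Lemma wythoff_cover k : exists n, k = A n \/ k = (A n + n)%N.
Proof.
have [->|k0] := posnP k; first by exists 0%N; left; rewrite lower_wythoff0.
have /andP[_ k2] := lower_wythoff_itv k; have k1 := lower_wythoff_lt k0.
have /andP[_ s2] := lower_wythoff_itv k.+1.
have s1 := lower_wythoff_lt (ltn0Sn k).
rewrite -natr1 in s1 s2.
have k1R : 1 <= k%:R :> R by rewrite ler1n.
have [f1 f2] := (phi_gt1, phi_lt2).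
have kA : (k <= A k)%N by rewrite -ltnS -(ltr_nat R) -natr1; nra.
have Ak : (A k <= k + k)%N by rewrite ltnW // -(ltr_nat R) natrD; nra.
have [gap|gap] := leqP (A k).+2 (A k.+1).
  (* Since k / phi = phi k - k, this witness is k / phi rounded up. *)
  exists ((A k).+1 - k)%N; left; apply/esym/lower_wythoff_eq.
  rewrite natrB 1?leqW // -natr1.
  have gapR : (A k)%:R + 2 <= (A k.+1)%:R :> R by rewrite -natrD ler_nat addn2.
  have lo : f * (f * k%:R) < f * ((A k)%:R + 1) by rewrite ltr_phi.
  have hi : f * ((A k)%:R + 2) < f * (f * (k%:R + 1)) by rewrite ltr_phi; lra.
  by rewrite !phi_mulK in lo hi; lra.
(* Since k / phi ^ 2 = 2 k - phi k, this witness is k / phi ^ 2 rounded up. *)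
exists (k + k - A k)%N; right.
suff -> : A (k + k - A k) = (A k - k)%N by lia.
have gapR : (A k.+1)%:R <= (A k)%:R + 1 :> R by rewrite natr1 ler_nat.
have lo : f * (A k)%:R < f * (f * k%:R) by rewrite ltr_phi.
have hi : f * (f * (k%:R + 1)) < f * ((A k)%:R + 2) by rewrite ltr_phi; lra.
rewrite !phi_mulK in lo hi.
by apply: lower_wythoff_eq; rewrite !natrB // natrD; lra.
Qed.

End Beatty.

(** * Positions of value 0 and of value 1 *)

Section Values.
Set Implicit Arguments.
Unset Strict Implicit.
Variable R : realType.
Local Notation A := (lower_wythoff R).

Definition wythoff_pair (p : position) : Prop :=
  exists n, p = (A n, A n + n) \/ p = (A n + n, A n).

Lemma wythoff_pairC a b : wythoff_pair (a, b) -> wythoff_pair (b, a).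
Proof. by case=> n [[-> ->]|[-> ->]]; exists n; [right | left]. Qed.

Lemma ew_legalC a b x y : ew_legal (a, b) x y = ew_legal (b, a) y x.
Proof. by rewrite /ew_legal /=; lia. Qed.

(** A one-pile move keeps an entry, and Wythoff pairs sharing an entry agree up to order, as lower
    and upper numbers are disjoint. A diagonal move keeps the difference, hence the index. *)
Lemma wythoff_pair_stable a b x y :
  wythoff_pair (a, b) -> ew_legal (a, b) x y -> ~ wythoff_pair (a - x, b - y).
Proof.
wlog [n [-> ->]] : a b x y / exists n, a = A n /\ b = A n + n.
  move=> H [n [[-> ->]|[-> ->]]].
    by apply: H; [exists n | exists n; left].
  rewrite ew_legalC => L /wythoff_pairC.
  by apply: H L; [exists n | exists n; left].
move=> _; rewrite /ew_legal /= => L [m H].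
have A0 := lower_wythoff0 R.
have [mn nm] := (@lower_wythoff_ltn R m n, @lower_wythoff_ltn R n m).
have [umn unm] := (@lower_upper_wythoff R m n, @lower_upper_wythoff R n m).
have [lt|lt|E] := ltngtP m n; last subst m.
- by case: H => -[]; lia.
- by case: H => -[]; lia.
case: H => -[]; first by lia.
have [n0|] := posnP n; last by lia.
by subst n; lia.
Qed.

(** The bounds [x < a] and [y < b] keep both piles nonempty, so that the same move stays legal when
    the position is translated by (-1, -1). *)
Lemma wythoff_pair_reach a b : 0 < a < b -> ~ wythoff_pair (a, b) ->
  exists x y, ew_legal (a, b) x y /\
    [/\ wythoff_pair (a - x, b - y), x < a & y < b].
Proof.
move=> /andP[a0 ab] nW; have A0 := lower_wythoff0 R.
have [m [Ea|Ea]] := wythoff_cover R a; last first.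
  have m0 : 0 < m by case: (posnP m) Ea => // ->; lia.
  have Am := @lower_wythoff_ltn R 0 m m0.
  exists 0, (b - A m); split; first by rewrite /ew_legal /=; lia.
  by split; [exists m; right; congr pair | | ]; lia.
have [lt|gt|Eb] := ltngtP b (A m + m); last by case: nW; exists m; left; congr pair.
  (* A diagonal move preserves the difference [d], and the Wythoff pair with this difference has
     index [d]. It lies below because [d < m]. *)
  pose d := b - a.
  have Ad : A d < A m by apply: lower_wythoff_ltn; rewrite /d; lia.
  have Ad0 : A 0 < A d by apply: lower_wythoff_ltn; rewrite /d; lia.
  exists (a - A d), (a - A d); split; first by rewrite /ew_legal /=; lia.
  by split; [exists d; left; congr pair | | ]; rewrite /d in Ad Ad0 *; lia.
exists 0, (b - (A m + m)); split; first by rewrite /ew_legal /=; lia.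
by split; [exists m; left; congr pair | | ]; lia.
Qed.

Lemma ew_grundy_eqP p g : ew_grundy p = g <->
  (forall q, q \in ew_options p -> ew_grundy q <> g) /\
  (forall k, k < g -> exists2 q, q \in ew_options p & ew_grundy q = k).
Proof.
rewrite ew_grundyE; split=> [/eqP/mexP[nin lt]|[nin lt]].
  split=> [q qp E|k /lt/mapP[q qp ->]]; last by exists q.
  by case/negP: nin; apply/mapP; exists q.
apply/eqP/mexP; split=> [|k /lt[q qp E]]; last by apply/mapP; exists q.
by apply/negP => /mapP[q /nin nq E]; case: nq.
Qed.

Lemma ew_grundy_eq0 p : ew_grundy p = 0 <-> wythoff_pair p.
Proof.
have [s] := ubnP (p.1 + p.2); elim: s p => // s IHs p ltps.
have IH q : q \in ew_options p -> ew_grundy q = 0 <-> wythoff_pair q.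
  by move=> /ew_options_lt qp; apply: IHs; lia.
rewrite ew_grundy_eqP; split=> [[nopt _]|Wp]; last first.
  split=> // q qp /IH -/(_ qp); move/ew_optionsP: qp => [x [y [L ->]]].
  by apply: wythoff_pair_stable L; case: p Wp {ltps IH}.
case: (pselect (wythoff_pair p)) => // nW; exfalso.
suff [x [y [L W]]] : exists x y, ew_legal p x y /\ wythoff_pair (p.1 - x, p.2 - y).
  have qp : (p.1 - x, p.2 - y) \in ew_options p by apply/ew_optionsP; exists x, y.
  by apply: (nopt _ qp); apply/IH.
case: p nW {nopt IH ltps} => a b /= nW.
wlog ab : a b nW / a <= b.
  move=> H; case: (leqP a b) => [|/ltnW ba]; first exact: H.
  have [|x [y [L /wythoff_pairC W]]] := H b a _ ba; first by move/wythoff_pairC.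
  by exists y, x; rewrite ew_legalC.
have W0 : wythoff_pair (0, 0) by exists 0; left; rewrite lower_wythoff0.
have [a0b|] := boolP (0 < a < b).
  by have [x [y [L [W _ _]]]] := wythoff_pair_reach a0b nW; exists x, y.
(* Here [a = 0] or [a = b], so one move takes everything. *)
move=> nab; exists a, b; rewrite !subnn; split=> //.
have : (a, b) <> (0, 0) by move=> E; apply: nW; rewrite E.
case: a b nab ab {nW} => [|a] [|b] //=; rewrite /ew_legal /=; lia.
Qed.

Lemma ew_grundy_eq1 p : ew_grundy p = 1 <-> wythoff_pair (p.1.+1, p.2.+1).
Proof.
have [s] := ubnP (p.1 + p.2); elim: s p => // s IHs p ltps.
have IH q : q \in ew_options p -> ew_grundy q = 1 <-> wythoff_pair (q.1.+1, q.2.+1).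
  by move=> /ew_options_lt qp; apply: IHs; lia.
split=> [G1|Wp]; last first.
  apply/ew_grundy_eqP; split=> [q qp /IH -/(_ qp)|[|//] _].
    case/ew_optionsP: qp => [x [y [L ->]]] /=.
    have : ew_legal (p.1.+1, p.2.+1) x y by move: L; rewrite /ew_legal /=; lia.
    move=> /(wythoff_pair_stable Wp).
    by move: L; rewrite /ew_legal => /and3P[L1 L2 _]; rewrite !subSn.
  (* The difference determines the index, so [p] and its translate by (1, 1) are not both Wythoff
     pairs. A nonzero value then yields an option of value 0. *)
  have : ew_grundy p <> 0.
    move/ew_grundy_eq0; case: Wp => n Hn [m Hm].
    have [mn nm] := (@lower_wythoff_ltn R m n, @lower_wythoff_ltn R n m).
    case: p Hn Hm {ltps IH} => a b /= Hn Hm.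
    have Emn : m = n by case: Hn Hm => -[? ?] [] []; lia.
    by subst m; case: Hn Hm => -[? ?] [] []; lia.
  have [qs|nq] := pselect (exists2 q, q \in ew_options p & ew_grundy q = 0) => //.
  case; apply/ew_grundy_eqP; split=> // q qp q0.
  by apply: nq; exists q.
case: (pselect (wythoff_pair (p.1.+1, p.2.+1))) => // nW; exfalso.
suff [x [y [L W]]] : exists x y, ew_legal p x y /\
    wythoff_pair ((p.1 - x).+1, (p.2 - y).+1).
  have qp : (p.1 - x, p.2 - y) \in ew_options p by apply/ew_optionsP; exists x, y.
  by move/ew_grundy_eqP: G1 => [/(_ _ qp) + _]; apply; apply/IH.
have nW0 : ~ wythoff_pair p by move/ew_grundy_eq0; rewrite G1.
case: p nW nW0 {G1 IH ltps} => a b /= nW nW0.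
wlog ab : a b nW nW0 / a <= b.
  move=> H; case: (leqP a b) => [|/ltnW ba]; first exact: H.
  have [||x [y [L /wythoff_pairC W]]] := H b a _ _ ba; try by move/wythoff_pairC.
  by exists y, x; rewrite ew_legalC.
have [lt|Eab] : a < b \/ a = b by lia.
  have [|x [y [L [W xa yb]]]] := @wythoff_pair_reach a.+1 b.+1 _ nW; first by lia.
  exists x, y; split; first by move: L; rewrite /ew_legal /=; lia.
  by rewrite -!subSn.
subst b; have a0 : 0 < a.
  by case: (posnP a) nW0 => // ->; case; exists 0; left; rewrite lower_wythoff0.
(* The target (0, 1) translates to (1, 2), the Wythoff pair of index 1. *)
exists a, a.-1; split; first by rewrite /ew_legal /=; lia.
have A1 : A 1 = 1.
  by apply: lower_wythoff_eq; rewrite mulr1; have [] := (phi_gt1 R, phi_lt2 R); lra.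
by exists 1; left; rewrite A1; congr pair; lia.
Qed.

End Values.

Theorem theorem3p2 (R : realType) (a b : nat) (hab : (a <= b)%N) :
  ew_grundy (a, b) = 1%N <->
  exists n : nat,
    [/\ (1 <= n)%N,
        (a%:Z = Num.floor (phi * n%:R : R) - 1)%R &
        (b%:Z = Num.floor (phi * n%:R : R) + n%:Z - 1)%R].
Proof.
rewrite (ew_grundy_eq1 R) /=; have A0 := lower_wythoff0 R; split=> [[n H]|[n]].
  have n0 : 0 < n by case: (posnP n) H => // ->; rewrite A0; case=> -[].
  (* For positive [n] the swapped pair contradicts [hab]. *)
  by exists n; rewrite floor_phi; case: H => -[]; split; lia.
by rewrite floor_phi => -[n0 Ea Eb]; exists n; left; congr pair; lia.
Qed.
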